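(* The iterated integral of $f_0(x)=\ln(x+a)$ is given by $$f_n(x) = -\frac{1}{n!}\sum_{k=1}^{n}\frac{x^k (x+a)^{n-k}}{k} - \frac{(x+a)^n-x^n}{n!}\,\ln a + \frac{(x+a)^n}{n!}\,\ln(x+a).$$
   Context: The iterated integrals of a function $f_0(x)$ are the functions $f_n$ defined by $f_n(x)=\int_0^x f_{n-1}(t)\,dt$ for $n\ge 1$; in particular $f_n(0)=0$ for $n\ge1$. *)

(* Defs.v *)
From Stdlib Require Import Reals.
From Coquelicot Require Import Coquelicot.
Open Scope R_scope.

(* [RInt] is the signed integral, so the value at x < 0 is meaningful. *)
Fixpoint iterated_integral (f0 : R -> R) (n : nat) : R -> R :=
  match n with
  | O => f0
  | S m => fun x => RInt (iterated_integral f0 m) 0 x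
  end.

(* Main.v *)
(** Write [F n] for the right-hand side and [S n] for its sum.  Then [F n 0 = 0]
    for [n >= 1], and [F (n+1)] is a primitive of [F n] because
    [S (n+1)' = (n+1) S n + (x+a)^n], which follows by induction on [n] from the
    recurrence [S (n+1) = (x+a) S n + x^(n+1)/(n+1)]. *)

Require Import Defs.
From Stdlib Require Import Reals Factorial Lra Lia.
From Coquelicot Require Import Coquelicot.
Open Scope R_scope.

Definition log_sum (a : R) (n : nat) (x : R) : R :=
  sum_n_m (fun k => x ^ k * (x + a) ^ (n - k) / INR k) 1 n.

Definition log_closed_form (a : R) (n : nat) (x : R) : R :=
  - (1 / INR (fact n)) * log_sum a n x
  - ((x + a) ^ n - x ^ n) / INR (fact n) * ln a
  + (x + a) ^ n / INR (fact n) * ln (x + a).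

Lemma log_sum_0 (a x : R) : log_sum a 0 x = 0.
Proof. unfold log_sum. now rewrite sum_n_m_zero by lia. Qed.

(** Each term with [k <= n] gains one factor [x + a], and the new term [k = S n] carries
    [(x + a) ^ 0]. *)
Lemma log_sum_S (a : R) (n : nat) (x : R) :
  log_sum a (S n) x = (x + a) * log_sum a n x + x ^ S n / INR (S n).
Proof.
  unfold log_sum.
  rewrite sum_n_Sm by lia.
  rewrite Nat.sub_diag, pow_O, Rmult_1_r.
  change plus with Rplus. f_equal.
  rewrite <- (sum_n_m_mult_l (K := R_Ring)).
  apply sum_n_m_ext_loc; intros k Hk.
  replace (S n - k)%nat with (S (n - k)) by lia.
  change mult with Rmult. simpl. unfold Rdiv. ring.
Qed.

Lemma log_sum_at_0 (a : R) (n : nat) : log_sum a n 0 = 0.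
Proof.
  induction n as [|n IH]; [apply log_sum_0|].
  rewrite log_sum_S, IH, pow_i by lia. unfold Rdiv. ring.
Qed.

Lemma is_derive_log_sum (a : R) (n : nat) (x : R) :
  is_derive (log_sum a (S n)) x (INR (S n) * log_sum a n x + (x + a) ^ n).
Proof.
  (* Product rule on the recurrence, with an arbitrary derivative [l] so that it serves both the
     base case and the induction step. *)
  assert (step : forall m l, is_derive (log_sum a m) x l ->
    is_derive (log_sum a (S m)) x (log_sum a m x + (x + a) * l + x ^ m)).
  { intros m l Hl.
    apply (is_derive_ext
      (fun t => (t + a) * log_sum a m t + t ^ S m / INR (S m))).
    { intros t. symmetry. apply log_sum_S. }
    pose proof (not_0_INR (S m) ltac:(lia)) as Hm.
    auto_derive.
    { now exists l. }
    replace (Derive _ x) with l by (symmetry; apply is_derive_unique, Hl).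
    change (match m with O => 1 | S _ => INR m + 1 end) with (INR (S m)).
    simpl pred. field. exact Hm. }
  induction n as [|n IH].
  - evar_last.
    + apply step with (l := 0).
      apply (is_derive_ext (fun _ => 0)); [|apply (is_derive_const 0)].
      intros t. symmetry. apply log_sum_0.
    + rewrite log_sum_0. simpl. ring.
  - evar_last.
    + apply step, IH.
    + pose proof (not_0_INR (S n) ltac:(lia)) as Hn.
      (* Multiplying the recurrence by [INR (S n)] turns its last term into the stray [x ^ S n]
         produced by [step]. *)
      rewrite (S_INR (S n)), !(log_sum_S a n).
      simpl pow. field. exact Hn.
Qed.

(** Differentiating the factor [ln (x + a)] yields [(x + a) ^ n / (n+1)!], which cancels the extra
    [(x + a) ^ n] from the derivative of the sum; elsewhere [(n+1) / (n+1)! = 1 / n!]. *)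
Lemma is_derive_log_closed_form (a : R) (n : nat) (x : R) (hx : - a < x) :
  is_derive (log_closed_form a (S n)) x (log_closed_form a n x).
Proof.
  unfold log_closed_form.
  pose proof (is_derive_log_sum a n x) as HS.
  pose proof (INR_fact_neq_0 n) as Hf.
  pose proof (INR_fact_neq_0 (S n)) as HfS.
  pose proof (not_0_INR (S n) ltac:(lia)) as Hn.
  auto_derive.
  - split; [eexists; exact HS|]. split; [lra|easy].
  - replace (Derive _ x) with (INR (S n) * log_sum a n x + (x + a) ^ n)
      by (symmetry; apply is_derive_unique, HS).
    change (match n with O => 1 | S _ => INR n + 1 end) with (INR (S n)).
    change (fact n + n * fact n)%nat with (fact (S n)).
    rewrite fact_simpl, mult_INR in *.
    simpl pred. simpl pow. field. repeat split; try assumption; lra.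
Qed.

Lemma log_closed_form_0 (a x : R) : log_closed_form a 0 x = ln (x + a).
Proof.
  unfold log_closed_form. rewrite log_sum_0. simpl. field.
Qed.

(** The sum vanishes at [0], and the [ln a] term, where [0 ^ S n = 0], cancels the [ln (x + a)]
    term. *)
Lemma log_closed_form_S_at_0 (a : R) (n : nat) : log_closed_form a (S n) 0 = 0.
Proof.
  unfold log_closed_form.
  rewrite log_sum_at_0, pow_i, Rplus_0_l by lia. unfold Rdiv. ring.
Qed.

Lemma continuous_log_closed_form (a : R) (n : nat) (x : R) (hx : - a < x) :
  continuous (log_closed_form a n) x.
Proof.
  apply (ex_derive_continuous (V := R_NormedModule)).
  (* Order [0] is treated apart because the derivative formula covers only successors. *)
  destruct n as [|n].
  - apply (ex_derive_ext (fun t => ln (t + a))).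
    { intros t. symmetry. apply log_closed_form_0. }
    auto_derive. lra.
  - eexists. now apply is_derive_log_closed_form.
Qed.

Lemma RInt_log_closed_form (a : R) (n : nat) (x : R)
  (ha : 0 < a) (hx : - a < x) :
  RInt (log_closed_form a n) 0 x = log_closed_form a (S n) x.
Proof.
  (* Both endpoints exceed [- a], so the whole interval of integration does, also when [x < 0]. *)
  assert (Hmin : - a < Rmin 0 x) by (apply Rmin_glb_lt; lra).
  apply is_RInt_unique. evar_last.
  - apply (is_RInt_derive (log_closed_form a (S n))); intros t Ht.
    + apply is_derive_log_closed_form; lra.
    + apply continuous_log_closed_form; lra.
  - rewrite log_closed_form_S_at_0. apply Rminus_0_r.
Qed.

Theorem theorem3p1 (a : R) (n : nat) (x : R) (ha : 0 < a) (hx : - a < x) :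
  iterated_integral (fun t => ln (t + a)) n x =
    - (1 / INR (fact n)) *
        sum_n_m (fun k => x ^ k * (x + a) ^ (n - k) / INR k) 1 n
    - ((x + a) ^ n - x ^ n) / INR (fact n) * ln a
    + (x + a) ^ n / INR (fact n) * ln (x + a).
Proof.
  change (iterated_integral (fun t => ln (t + a)) n x = log_closed_form a n x).
  (* The induction hypothesis is needed at every [t] between [0] and [x], not just at [x]. *)
  revert x hx. induction n as [|n IH]; intros x hx.
  - symmetry. apply log_closed_form_0.
  - rewrite <- RInt_log_closed_form by assumption.
    simpl. apply RInt_ext. intros t Ht. apply IH.
    assert (- a < Rmin 0 x) by (apply Rmin_glb_lt; lra). lra.
Qed.
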